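(* Let $m\ge 1$ be an integer and let $(X_k)_{k=-\infty}^{\infty}$ be a strictly stationary sequence of $m$-dependent real random variables with finite variance. Let $S_n:=\sum_{i=1}^n X_i$ and let $\sigma^2:=\lim_{n\to\infty} n^{-1}\operatorname{Var}(S_n)$, which is also given by $$\sigma^2=\operatorname{Var}(X_0)+2\sum_{k=1}^m \operatorname{Cov}(X_0,X_k).$$ If $\sigma^2=0$, then there exist a strictly stationary sequence $(Y_k)_{k=-\infty}^{\infty}$ of $(m-1)$-dependent random variables with finite variance (defined on the same probability space as $(X_k)$) and a constant $\mu\in\mathbb R$ such that, for every $k\in\mathbb Z$, $$X_k=Y_k-Y_{k-1}+\mu\quad\text{a.s.}$$ The random variables $Y_k$ are a.s. unique up to an additive constant: if $(Y'_k)_{k=-\infty}^{\infty}$ is another strictly stationary $(m-1)$-dependent sequence with finite variance and $\mu'$ is a constant such that $X_k=Y'_k-Y'_{k-1}+\mu'$ a.s. for every $k$, then there is a constant $C$ such that $Y'_k=Y_k+C$ a.s. for every $k$. Conversely, for any strictly stationary sequence $(Y_k)_{k=-\infty}^{\infty}$ of $(m-1)$-dependent random variables with finite variance and any constant $\mu\in\mathbb R$, the sequence $X_k:=Y_k-Y_{k-1}+\mu$, $k\in\mathbb Z$, is strictly stationary and $m$-dependent and has $\sigma^2=0$.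
   Context: For an integer $m\ge 0$, a strictly stationary sequence $(X_k)_{k=-\infty}^\infty$ of random variables is called $m$-dependent if $(X_k)_{k\le 0}$ is independent of $(X_k)_{k\ge m+1}$ (hence, by stationarity, $(X_k)_{k\le j}$ is independent of $(X_k)_{k\ge j+m+1}$ for every $j\in\mathbb Z$). In particular, a strictly stationary $0$-dependent sequence is an i.i.d. sequence. Strictly stationary means that the joint distribution of the whole sequence is invariant under shifts of the index. Finite variance means $\mathbb E X_k^2<\infty$. *)

(* Defs.v *)
From HB Require Import structures.
From mathcomp Require Import all_boot all_order all_algebra.
From mathcomp Require Import all_classical all_reals all_analysis.
From mathcomp Require Import measurable_realfun.
Import Order.TTheory GRing.Theory Num.Theory.
Import numFieldNormedType.Exports.

Set Implicit Arguments.
Unset Strict Implicit.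
Unset Printing Implicit Defensive.

Local Open Scope classical_set_scope.
Local Open Scope ring_scope.

(* sigma(f_k : k in K).  With f the coordinate maps of a power T'^I and K = setT
   this is the product sigma-algebra on T'^I. *)
Definition sigma_family {I U : Type} {d} {T' : measurableType d}
    (f : I -> U -> T') (K : set I) : set (set U) :=
  <<s \bigcup_(k in K) preimage_set_system setT (f k) measurable >>.

Definition seq_measurable (R : realType) : set (set (int -> R)) :=
  sigma_family (fun (k : int) (x : int -> R) => x k) setT.

Section processes.
Context {d : measure_display} {T : measurableType d} {R : realType}.
Variable P : probability T R.
Implicit Types X : int -> {RV P >-> R}.

Definition joint_law X (A : set (int -> R)) : \bar R :=
  P [set w | A (fun k => X k w)].

Definition strictly_stationary X : Prop :=
  forall (h : int) (A : set (int -> R)), seq_measurable A ->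
    joint_law (fun k => X (k + h)) A = joint_law X A.

Definition indep_families X (K L : set int) : Prop :=
  forall A B : set T, sigma_family X K A -> sigma_family X L B ->
    P (A `&` B) = (P A * P B)%E.

(* Only meant for strictly stationary sequences: independence is required at the
   origin only, and stationarity propagates it to every index. *)
Definition m_dependent (m : nat) X : Prop :=
  indep_families X [set k | k <= 0] [set k | m.+1%:Z <= k].

Definition finite_variance X : Prop :=
  forall k, ('E_P[fun w => (X k w ^+ 2)%R] < +oo)%E.

Definition partial_sum X (n : nat) : T -> R :=
  fun w => \sum_(1 <= i < n.+1) X i%:Z w.

Definition normalized_var X (n : nat) : \bar R :=
  ((n%:R^-1)%:E * 'V_P[partial_sum X n])%E.

(* A total operator: meaningful when [cvgn (normalized_var X)]. *)
Definition sigma2 X : \bar R := limn (normalized_var X).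

End processes.

(* Main.v *)
(* Subtract the mean of X and let W be the walk with increments X_k, W_0 = 0.  By
   m-dependence Var(W_b - W_a) is affine in |b - a| once |b - a| >= m, with slope
   sigma^2; so if sigma^2 = 0 it equals a constant c for all |b - a| >= m.  If
   X_k = Y_k - Y_(k-1) with E Y_k = 0, then Y_0 = Y_b - W_b, and averaging over many b lets the terms
   Y_b cancel by the law of large numbers.  Hence Y_0 should be the limit of minus the
   averages of W_b over b = -p, -2p, ..., -Np, where p = m + 1.  The difference between
   two such averages, of lengths N and M, has second moment at most c/2 (1/N + 1/M),
   so they converge almost surely along N = 4^k.  The same bound compares them with
   the averages over b = p, 2p, ..., Np: the limit is the same almost surely.  Thus Y_k
   is a function of (X_i)_(i <= k), and also, almost surely, of (X_i)_(i > k), and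
   therefore Y is (m-1)-dependent.  Uniqueness follows from the same averages: the
   difference of two solutions does not depend on k, hence equals its average over
   sparse times, which converges to a constant. *)
Require Import Defs.
From HB Require Import structures.
From mathcomp Require Import all_boot all_order all_algebra.
From mathcomp Require Import all_classical all_reals all_analysis.
From mathcomp Require Import measurable_realfun.
From mathcomp Require Import ring lra zify.
Import Order.TTheory GRing.Theory Num.Theory.
Import numFieldNormedType.Exports.

Set Implicit Arguments.
Unset Strict Implicit.
Unset Printing Implicit Defensive.

Local Open Scope classical_set_scope.
Local Open Scope ring_scope.

(** * Sigma-algebras generated by families of maps *)

Section sigma_families.
Context {I U : Type} {d'} {T' : measurableType d'}.
Implicit Types (f : I -> U -> T') (K : set I).

Lemma sigma_family_sigma_algebra f K : sigma_algebra setT (sigma_family f K).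
Proof. exact: smallest_sigma_algebra. Qed.

Lemma sigma_family_coord f K k B :
  K k -> measurable B -> sigma_family f K (f k @^-1` B).
Proof.
move=> Kk mB; apply: sub_sigma_algebra; exists k => //.
by exists B => //; rewrite setTI.
Qed.

Lemma sigma_family_min f K (G : set (set U)) : sigma_algebra setT G ->
    (forall k B, K k -> measurable B -> G (f k @^-1` B)) ->
  sigma_family f K `<=` G.
Proof.
move=> sG fG; apply: smallest_sub => // _ [k Kk [B mB <-]].
by rewrite setTI; exact: fG.
Qed.

End sigma_families.

Lemma sigma_family_measurable {I} {d'} {T' : measurableType d'} d (T : measurableType d) (f : I -> T -> T') (K : set I) :
    (forall k, K k -> measurable_fun setT (f k)) ->
  sigma_family f K `<=` measurable.
Proof.
move=> mf; apply: sigma_family_min; first exact: sigma_algebra_measurable.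
by move=> k B Kk mB; rewrite -[X in measurable X]setTI; exact: mf.
Qed.

Lemma sigma_family_reindex {I J U : Type} {d'} {T' : measurableType d'}
    (f : I -> U -> T') (s : J -> I) (K : set J) (L : set I) :
  s @` K `<=` L -> sigma_family (fun j => f (s j)) K `<=` sigma_family f L.
Proof.
move=> sKL; apply: sigma_family_min; first exact: sigma_family_sigma_algebra.
by move=> k B Kk mB; apply: sigma_family_coord => //; apply: sKL; exists k.
Qed.

Lemma sigma_family_preimage {I U V : Type} {d'} {T' : measurableType d'}
    (f : I -> V -> T') (g : U -> V) (K : set I) (A : set V) :
  sigma_family f K A -> sigma_family (fun k u => f k (g u)) K (g @^-1` A).
Proof.
move: A; apply: (sigma_family_min
  (G := [set A | sigma_family (fun k u => f k (g u)) K (g @^-1` A)])); last first.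
  by move=> k B Kk mB; exact: (sigma_family_coord (f := fun k u => f k (g u))).
case: (sigma_family_sigma_algebra (fun k u => f k (g u)) K) => G0 GC GU.
split => [|A GA|F GF]; first exact: G0.
  by have := GC _ GA; rewrite !setTD.
by rewrite /= preimage_bigcup; exact: GU.
Qed.

Lemma sigma_family_seq_preimage {R : realType} {U : Type} (g : U -> int -> R)
    (K : set int) (A : set (int -> R)) :
    sigma_family (fun k (x : int -> R) => x k) K A ->
  sigma_family (fun k u => g u k) K (g @^-1` A).
Proof. exact: sigma_family_preimage. Qed.

(** The sequence space with only the sigma-algebra of the coordinates in [K]. A real functional
    measurable on it is determined by these coordinates, so that statements about past or future
    become statements about measurability. *)
Definition coord_type (R : realType) (K : set int) :=
  g_sigma_algebraType (\bigcup_(k in K)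
    preimage_set_system setT (fun x : int -> R => x k) measurable).

HB.instance Definition _ (R : realType) K := Measurable.on (coord_type R K).

Section coord_type.
Context {R : realType}.
Implicit Types (K L : set int).

Lemma measurable_coord K k : K k ->
  measurable_fun setT (fun x : coord_type R K => x k).
Proof.
move=> Kk _ B mB; rewrite setTI.
exact: (sigma_family_coord (f := fun k (x : int -> R) => x k)).
Qed.

Lemma measurable_coord_reindex d' (T' : measurableType d') K L (s : int -> int)
    (phi : coord_type R K -> T') :
    s @` K `<=` L -> measurable_fun setT phi ->
  measurable_fun setT (fun x : coord_type R L => phi (fun i => x (s i))).
Proof.
move=> sKL mphi _ B mB; rewrite setTI.
have := mphi measurableT B mB; rewrite setTI => phiB.
apply: (sigma_family_reindex (f := fun k (x : int -> R) => x k) (s := s) sKL).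
exact: (sigma_family_seq_preimage (g := fun (x : int -> R) i => x (s i)) phiB).
Qed.

(** Used to locate a process built from [X] by functionals [phi k] inside the past or the future of
    [X]. *)
Lemma sigma_family_factor U (X : int -> U -> R) K L
    (phi : int -> (int -> R) -> R) :
    (forall k, K k -> measurable_fun setT (phi k : coord_type R L -> R)) ->
  sigma_family (fun k u => phi k (fun i => X i u)) K `<=` sigma_family X L.
Proof.
move=> mphi; apply: sigma_family_min; first exact: sigma_family_sigma_algebra.
move=> k B Kk mB; have := mphi k Kk measurableT B mB; rewrite setTI => phiB.
exact: (sigma_family_seq_preimage (g := fun u i => X i u) phiB).
Qed.

Lemma measurable_seq_of d (T : measurableType d) K (X : int -> T -> R) :
    (forall k, K k -> measurable_fun setT (X k)) ->
  measurable_fun setT ((fun w k => X k w) : T -> coord_type R K).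
Proof.
move=> mX _ B mB; rewrite setTI.
by apply: (sigma_family_measurable mX); exact: sigma_family_seq_preimage mB.
Qed.

End coord_type.

(** * Stationarity and independence of processes built from a given one *)

Section stationary_dependent.
Context {d : measure_display} {T : measurableType d} {R : realType}.
Variable P : probability T R.
Implicit Types X Y : int -> {RV P >-> R}.

(** The map [Phi] from paths of [X] to paths of [Y] commutes with shifts, so an event of the shifted
    [Y] is the pulled-back event of the equally shifted [X]. *)
Lemma strictly_stationary_factor X Y (phi : (int -> R) -> R) :
    strictly_stationary X ->
    measurable_fun setT (phi : coord_type R setT -> R) ->
    (forall k w, Y k w = phi (fun i => X (k + i) w)) ->
  strictly_stationary Y.
Proof.
move=> sX mphi YE h A mA.
pose Phi (x : int -> R) k := phi (fun i => x (k + i)).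
have mPhi : seq_measurable (Phi @^-1` A).
  apply: (sigma_family_factor (X := fun k (x : int -> R) => x k)
    (phi := fun k x => phi (fun i => x (k + i)))); last first.
    exact: (sigma_family_seq_preimage (g := Phi) mA).
  by move=> k _; exact: (measurable_coord_reindex (s := fun i => k + i) _ mphi).
have JE h' : joint_law (fun k => Y (k + h')) A =
    joint_law (fun k => X (k + h')) (Phi @^-1` A).
  congr (P _); apply/funext => w /=; congr (A _); apply/funext => k.
  by rewrite /Phi YE; congr phi; apply/funext => i; rewrite addrAC.
have J0 Z B : joint_law (fun k => Z (k + 0)) B = joint_law Z B :> \bar R.
  by congr (joint_law _ B); apply/funext => k; rewrite addr0.
by rewrite JE sX// -J0 -JE J0.
Qed.

(* The times in [L] only need a [G]-measurable version [Z] of [Y]: on the complement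
   of a null set, every event of [Y] over [L] agrees with an event in [G]. *)
Lemma indep_families_ae Y (Z : int -> T -> R) (K L : set int) (F G : set (set T)) :
    sigma_algebra setT G -> G `<=` measurable -> F `<=` measurable ->
    (forall A B, F A -> G B -> P (A `&` B) = (P A * P B)%E) ->
    sigma_family Y K `<=` F -> sigma_family Z L `<=` G ->
    {ae P, forall w, forall k, Y k w = Z k w} ->
  indep_families Y K L.
Proof.
move=> sG Gm Fm FG YF ZG [N [mN PN NYZ]] A B YA YB.
have {NYZ} YZ w k : ~ N w -> Y k w = Z k w.
  by move=> nN; apply: contrapT => nYZ; apply: nN; apply: NYZ => /= /(_ k).
have [B' GB' BB'] : exists2 B', G B' & B `&` ~` N = B' `&` ~` N.
  move: {A YA} B YB; apply: (sigma_family_min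
    (G := [set B | exists2 B', G B' & B `&` ~` N = B' `&` ~` N])); last first.
    move=> k B Lk mB; exists (Z k @^-1` B).
      by apply: ZG; exact: sigma_family_coord.
    by apply/seteqP; split=> w /= [YB nN]; split=> //; rewrite ?YZ// -?YZ.
  case: sG => G0 GC GU; split; [by exists set0|..].
  - move=> A [A' GA' AA']; exists (setT `\` A'); first exact: GC.
    rewrite !setTD; apply/seteqP; split=> w [nA nN]; split=> // aw; apply: nA.
      by have : (A' `&` ~` N) w by []; rewrite -AA' => -[].
    by have : (A `&` ~` N) w by []; rewrite AA' => -[].
  - move=> A A'; have /choice[A1 A1P] k : exists B', G B' /\ A k `&` ~` N = B' `&` ~` N.
      by have [B' ? ?] := A' k; exists B'.
    exists (\bigcup_k A1 k); first by apply: GU => k; have [] := A1P k.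
    by rewrite !setI_bigcupl; apply: eq_bigcupr => k _; have [] := A1P k.
have mA : measurable A by apply/Fm/YF.
have mB' : measurable B' by exact: Gm.
have mB : measurable B.
  by apply: (sigma_family_measurable (f := Y) (K := L)).
(* Deleting the null set [N] changes no probability; this allows [B] to be exchanged for [B']. *)
have PE C : measurable C -> P C = P (C `&` ~` N).
  move=> mC; rewrite -setDE measureD ?PN//.
  - rewrite [X in (_ - X)%E](_ : _ = 0%E) ?sube0//.
    by apply/eqP; rewrite eq_le measure_ge0 andbT -PN le_measure ?inE//; exact: measurableI.
  - by rewrite ltey_eq fin_num_measure.
rewrite PE; last exact: measurableI.
rewrite -setIA BB' setIA -PE; last exact: measurableI.
by rewrite (PE B)// BB' -PE// FG//; exact: YF.
Qed.

End stationary_dependent.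

(** * Expectations under stationarity and independence *)

Section expectation.
Context {d : measure_display} {T : measurableType d} {R : realType}.
Variable P : probability T R.
Implicit Types X Y : int -> {RV P >-> R}.

Lemma Lfun1_sub2 (f : T -> R) : f \in Lfun P 2%:E -> f \in Lfun P 1.
Proof. by apply: Lfun_subset12; exact: fin_num_measure. Qed.

Lemma Lfun_measurable p (f : T -> R) : f \in Lfun P p -> measurable_fun setT f.
Proof. by rewrite inE => /andP[/[!inE]]. Qed.

Lemma Lfun2_expectation (f : T -> R) : measurable_fun setT f ->
  (f \in Lfun P 2%:E) = ('E_P[fun w => (f w ^+ 2)%R] < +oo)%E.
Proof.
move=> mf; apply/idP/idP => [/Lfun2_integrable_sqr /integrableP[_]|].
  rewrite unlock; apply: le_lt_trans; apply: ge0_le_integral => //.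
  - by move=> x _; rewrite lee_fin sqr_ge0.
  - by apply/measurable_EFinP; exact: measurable_funX.
  - by apply: measurableT_comp => //; apply/measurable_EFinP; exact: measurable_funX.
  - by move=> x _ /=; rewrite lee_fin ler_norm.
move=> f2; rewrite inE; apply/andP; split; rewrite inE//=.
rewrite /finite_norm unlock /Lnorm poweR_lty//.
by move: f2; rewrite unlock; congr (_ < _)%E; apply: eq_integral => x _;
  rewrite /= powR_mulrn// -normrX ger0_norm// sqr_ge0.
Qed.

Lemma Lfun2_finite_variance X : finite_variance X ->
  forall k, (X k : T -> R) \in Lfun P 2%:E.
Proof. by move=> X2 k; rewrite Lfun2_expectation. Qed.

(** Both sides integrate [psi] over the sequence space, against the laws of two shifts of [X];
    stationarity says that these laws agree. *)
Lemma strictly_stationary_expectation X (psi : (int -> R) -> R) h :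
    strictly_stationary X ->
    measurable_fun setT (psi : coord_type R setT -> R) ->
    (forall h, (fun w => psi (fun k => X (k + h) w)) \in Lfun P 1) ->
  ('E_P[fun w => psi (fun k => X (k + h)%R w)] =
   'E_P[fun w => psi (fun k => X k w)])%E.
Proof.
move=> sX mpsi ipsi.
have seqm h' : measurable_fun setT
    ((fun w k => X (k + h') w) : T -> coord_type R setT).
  exact: (measurable_seq_of (X := fun k => X (k + h'))).
have X0 w : (fun k => X k w) = (fun k => X (k + 0) w).
  by apply/funext => k; rewrite addr0.
under [in RHS]eq_fun do rewrite X0.
pose V h' : {mfun T >-> coord_type R setT} := mfun_Sub (mem_set (seqm h')).
have EV h' : ('E_P[fun w => psi (fun k => X (k + h')%R w)] =
    \int[distribution P (V h')]_x (psi x)%:E)%E.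
  rewrite unlock integral_distribution//; first exact/measurable_EFinP.
  by apply/Lfun1_integrable; exact: ipsi.
rewrite !EV; apply: eq_measure_integral => A mA _.
rewrite /distribution /pushforward /=.
have := sX h A mA; rewrite /joint_law /= => XA.
transitivity (P [set w | A (fun k => X k w)]); first exact: XA.
by congr (P _); apply/funext => w /=; rewrite /preimage /= X0.
Qed.

(** By independence the law of the pair agrees with the product of the marginal laws on rectangles,
    hence everywhere; Fubini then factors the integral. *)
Lemma expectation_indepM (U V : {RV P >-> R}) :
    (forall A B, measurable A -> measurable B ->
      P (U @^-1` A `&` V @^-1` B) = (P (U @^-1` A) * P (V @^-1` B))%E) ->
    (U : T -> R) \in Lfun P 2%:E -> (V : T -> R) \in Lfun P 2%:E ->
  ('E_P[((U : T -> R) * V)%R] = 'E_P[U] * 'E_P[V])%E.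
Proof.
move=> UV U2 V2.
have mW : measurable_fun setT (fun w => (U w, V w)).
  exact: measurable_fun_pair.
pose W : {mfun T >-> (R * R)%type} := mfun_Sub (mem_set mW).
pose f (z : R * R) : \bar R := (z.1 * z.2)%:E.
have mf : measurable_fun setT f.
  by apply/measurable_EFinP; exact: measurable_funM.
have iUV : P.-integrable setT (f \o W).
  by apply/Lfun1_integrable; exact: Lfun2_mul_Lfun1.
pose m1 := distribution P U; pose m2 := distribution P V.
have mE A : measurable A -> distribution P W A = (m1 \x m2)%E A.
  by move=> mA; apply/esym/product_measure_unique.
have if12 : (m1 \x m2)%E.-integrable setT f.
  apply/integrableP; split=> //.
  have /integrableP[_] : (distribution P W).-integrable setT f.
    exact: integrable_pushforward.
  apply: le_lt_trans; rewrite le_eqVlt; apply/orP; left; apply/eqP.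
  by apply: eq_measure_integral => A mA _; apply/esym; exact: mE.
have i1 : m1.-integrable setT (EFin : R -> \bar R).
  apply: integrable_pushforward => //.
  by apply/Lfun1_integrable; exact: Lfun1_sub2.
have i2 : m2.-integrable setT (EFin : R -> \bar R).
  apply: integrable_pushforward => //.
  by apply/Lfun1_integrable; exact: Lfun1_sub2.
have E1 : ('E_P[U] = \int[m1]_x x%:E)%E.
  rewrite unlock integral_distribution//.
  by apply/Lfun1_integrable; exact: Lfun1_sub2.
have E2 : ('E_P[V] = \int[m2]_x x%:E)%E.
  rewrite unlock integral_distribution//.
  by apply/Lfun1_integrable; exact: Lfun1_sub2.
have E12 : ('E_P[((U : T -> R) * V)%R] = \int[distribution P W]_z f z)%E.
  by rewrite unlock integral_distribution.
rewrite E12 (eq_measure_integral (m1 \x m2)%E); last by move=> A mA _; exact: mE.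
rewrite -integral12_prod_meas1//= /fubini_F /f /=.
have inner (x : R) : (\int[m2]_y (x * y)%:E = x%:E * 'E_P[V])%E.
  by rewrite E2 -integralZl.
under eq_integral do rewrite inner.
have /fineK <- : ('E_P[V])%E \is a fin_num by rewrite expectation_fin_num// Lfun1_sub2.
by rewrite integralZr// E1.
Qed.

End expectation.

(** * Algebra of finite averages *)

Definition avg {R : realType} (N : nat) (a : nat -> R) : R :=
  N%:R^-1 * \sum_(i < N) a i.

Section averages.
Context {R : realType}.
Implicit Types (a b : nat -> R) (N M : nat).

Lemma avgB N a b : avg N a - avg N b = avg N (fun i => a i - b i).
Proof. by rewrite /avg -mulrBr sumrB. Qed.

Lemma avg_cst N (c : R) : (0 < N)%N -> avg N (fun=> c) = c.
Proof.
move=> N0; rewrite /avg sumr_const card_ord -[c *+ N]mulr_natl mulKf//.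
by rewrite pnatr_eq0 -lt0n.
Qed.

Lemma sum_sqrB N M a b : \sum_(i < N) \sum_(j < M) (a i - b j) ^+ 2 =
  M%:R * (\sum_(i < N) a i ^+ 2) - 2 * (\sum_(i < N) a i) * (\sum_(j < M) b j)
    + N%:R * (\sum_(j < M) b j ^+ 2).
Proof.
have row (x : R) : \sum_(j < M) (x - b j) ^+ 2 =
    M%:R * x ^+ 2 - 2 * (\sum_(j < M) b j) * x + \sum_(j < M) b j ^+ 2.
  rewrite (eq_bigr (fun j : 'I_M => x ^+ 2 - 2 * x * b j + b j ^+ 2)); last first.
    by move=> j _; ring.
  rewrite big_split sumrB /= sumr_const card_ord -mulr_sumr -mulr_natl.
  by ring.
rewrite (eq_bigr _ (fun (i : 'I_N) _ => row (a i))) big_split sumrB /= -!mulr_sumr.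
by rewrite sumr_const card_ord -mulr_natl; ring.
Qed.

(* Only the differences [a i - b j], [a i - a j] and [b i - b j] occur on the right:
   the variances of these increments are all that is known about a random walk. *)
Lemma sqr_avgB N M a b : (0 < N)%N -> (0 < M)%N ->
  (avg N a - avg M b) ^+ 2 =
    (N%:R * M%:R)^-1 * (\sum_(i < N) \sum_(j < M) (a i - b j) ^+ 2)
    - (2 * N%:R ^+ 2)^-1 * (\sum_(i < N) \sum_(j < N) (a i - a j) ^+ 2)
    - (2 * M%:R ^+ 2)^-1 * (\sum_(i < M) \sum_(j < M) (b i - b j) ^+ 2).
Proof.
move=> N0 M0; rewrite !sum_sqrB /avg.
have {}N0 : N%:R != 0 :> R by rewrite pnatr_eq0 -lt0n.
have {}M0 : M%:R != 0 :> R by rewrite pnatr_eq0 -lt0n.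
by field; rewrite N0 M0.
Qed.

(** There are [N^2 - N] off-diagonal pairs, and the diagonal contributes a nonnegative amount. *)
Lemma sum_offdiag_ge N (m : nat -> nat -> R) c : (forall i, 0 <= m i i) ->
    (forall i j, i != j -> c <= m i j) ->
  c * (N%:R ^+ 2 - N%:R) <= \sum_(i < N) \sum_(j < N) m i j.
Proof.
move=> m0 mc.
have -> : c * (N%:R ^+ 2 - N%:R) = \sum_(i < N) \sum_(j < N) (c - c * (i == j)%:R).
  have row (i : 'I_N) : \sum_(j < N) (c - c * (i == j)%:R) = c * (N%:R - 1).
    rewrite sumrB -mulr_sumr sumr_const card_ord (bigD1 i)//= eqxx big1.
      by rewrite -[c *+ N]mulr_natr mulr1n addr0 mulrBr.
    by move=> j /negbTE ji; rewrite eq_sym ji.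
  by rewrite (eq_bigr _ (fun i _ => row i)) sumr_const card_ord -mulr_natl; ring.
apply: ler_sum => i _; apply: ler_sum => j _.
have [->|ij] := eqVneq i j; first by rewrite mulr1 subrr.
by rewrite mulr0 subr0; exact: mc.
Qed.

End averages.

(** * Real-valued means, and almost sure convergence from second moments *)

Section mean.
Context {d : measure_display} {T : measurableType d} {R : realType}.
Variable P : probability T R.
Implicit Types (f g : T -> R) (F : nat -> T -> R).

(** Real-valued, so that moments can be handled by field arithmetic; meaningful for integrable
    [f]. *)
Definition mean f : R := fine ('E_P[f])%E.

Lemma meanK f : f \in Lfun P 1 -> (mean f)%:E = ('E_P[f])%E.
Proof. by move=> f1; rewrite fineK// expectation_fin_num. Qed.

Lemma mean_ge0 f : (forall w, 0 <= f w) -> 0 <= mean f.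
Proof. by move=> f0; rewrite fine_ge0// expectation_ge0. Qed.

Lemma mean_cst c : mean (fun=> c) = c.
Proof. by rewrite /mean expectation_cst. Qed.

Lemma meanZ c f : f \in Lfun P 1 -> mean (fun w => c * f w) = c * mean f.
Proof.
move=> f1; rewrite -[RHS]/(fine (c * mean f)%:E) EFinM meanK//.
rewrite -expectationZl//; congr (fine 'E_P[_])%E.
by apply/funext => w /=; rewrite mulrC.
Qed.

Lemma meanD f g : f \in Lfun P 1 -> g \in Lfun P 1 ->
  mean (fun w => f w + g w) = mean f + mean g.
Proof.
move=> f1 g1; rewrite -[RHS]/(fine (mean f + mean g)%:E) EFinD !meanK//.
by rewrite -expectationD.
Qed.

Lemma meanB f g : f \in Lfun P 1 -> g \in Lfun P 1 ->
  mean (fun w => f w - g w) = mean f - mean g.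
Proof.
move=> f1 g1; rewrite -[RHS]/(fine (mean f - mean g)%:E) EFinB !meanK//.
by rewrite -expectationB.
Qed.

Lemma Lfun_sum p I (s : seq I) (G : I -> T -> R) : (1 <= p)%E ->
  (forall i, G i \in Lfun P p) -> (fun w => \sum_(i <- s) G i w) \in Lfun P p.
Proof. by move=> p1 GL; rewrite -fct_sumE rpred_sum. Qed.

Lemma Lfun_mulr p c f : (1 <= p)%R -> f \in Lfun P p%:E ->
  (fun w => c * f w) \in Lfun P p%:E.
Proof.
move=> p1 fL; rewrite (_ : (fun w => _) = c \o* f); first exact: Lfun_scale.
by apply/funext => w /=; rewrite mulrC.
Qed.

Lemma Lfun2_sqr f : f \in Lfun P 2%:E -> (fun w => f w ^+ 2) \in Lfun P 1.
Proof. by move=> f2; exact: (Lfun2_mul_Lfun1 f2 f2). Qed.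

Lemma Lfun2_mul f g : f \in Lfun P 2%:E -> g \in Lfun P 2%:E ->
  (fun w => f w * g w) \in Lfun P 1.
Proof. exact: Lfun2_mul_Lfun1. Qed.

Lemma Lfun2B f g : f \in Lfun P 2%:E -> g \in Lfun P 2%:E ->
  (fun w => f w - g w) \in Lfun P 2%:E.
Proof. by move=> f2 g2; rewrite -[X in X \in _]/(f - g) rpredB// ?lee1n. Qed.

Lemma Lfun2D f g : f \in Lfun P 2%:E -> g \in Lfun P 2%:E ->
  (fun w => f w + g w) \in Lfun P 2%:E.
Proof. by move=> f2 g2; rewrite -[X in X \in _]/(f + g) rpredD// ?lee1n. Qed.

Lemma mean_sum I (s : seq I) (G : I -> T -> R) : (forall i, G i \in Lfun P 1) ->
  mean (fun w => \sum_(i <- s) G i w) = \sum_(i <- s) mean (G i).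
Proof.
move=> G1; elim: s => [|i s ih].
  by under eq_fun do rewrite big_nil; rewrite mean_cst big_nil.
under eq_fun do rewrite big_cons; rewrite meanD ?ih ?big_cons//.
exact: Lfun_sum.
Qed.

Lemma Lfun2_avg N F : (forall i, F i \in Lfun P 2%:E) ->
  (fun w => avg N (F ^~ w)) \in Lfun P 2%:E.
Proof.
by move=> F2; apply: Lfun_mulr; [rewrite ler1n|apply: Lfun_sum => //; rewrite lee1n].
Qed.

(** Take means in [sqr_avgB]; off-diagonal pairs form the fraction [1 - 1/N] of all pairs. For
    [M = 1] the bound on [G] is vacuous, which allows comparison of an average with a single
    variable. *)
Lemma mean_sqr_avgB N M F G a b c :
    (0 < N)%N -> (0 < M)%N ->
    (forall i, F i \in Lfun P 2%:E) -> (forall i, G i \in Lfun P 2%:E) ->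
    (forall i j, mean (fun w => (F i w - G j w) ^+ 2) <= a) ->
    (forall i j, i != j -> b <= mean (fun w => (F i w - F j w) ^+ 2)) ->
    ((1 < M)%N -> forall i j, i != j -> c <= mean (fun w => (G i w - G j w) ^+ 2)) ->
  mean (fun w => (avg N (F ^~ w) - avg M (G ^~ w)) ^+ 2) <=
    a - b / 2 * (1 - N%:R^-1) - c / 2 * (1 - M%:R^-1).
Proof.
move=> N0 M0 F2 G2 FGa Fb Gc.
have sqr1 (f g : T -> R) : f \in Lfun P 2%:E -> g \in Lfun P 2%:E ->
    (fun w => (f w - g w) ^+ 2) \in Lfun P 1.
  by move=> f2 g2; apply: Lfun2_sqr; exact: Lfun2B.
have sum1 (H K : nat -> T -> R) n m :
    (forall i, H i \in Lfun P 2%:E) -> (forall i, K i \in Lfun P 2%:E) ->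
    (fun w => \sum_(i < n) \sum_(j < m) (H i w - K j w) ^+ 2) \in Lfun P 1.
  by move=> H2 K2; do 2![apply: Lfun_sum => // ?]; exact: sqr1.
have meanss (H K : nat -> T -> R) n m :
    (forall i, H i \in Lfun P 2%:E) -> (forall i, K i \in Lfun P 2%:E) ->
    mean (fun w => \sum_(i < n) \sum_(j < m) (H i w - K j w) ^+ 2) =
    \sum_(i < n) \sum_(j < m) mean (fun w => (H i w - K j w) ^+ 2).
  move=> H2 K2; rewrite mean_sum; last first.
    by move=> i; apply: Lfun_sum => // j; exact: sqr1.
  by apply: eq_bigr => i _; rewrite mean_sum// => j; exact: sqr1.
under eq_fun do rewrite sqr_avgB//.
have Lr c' f : f \in Lfun P 1 -> (fun w => c' * f w) \in Lfun P 1.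
  exact: Lfun_mulr.
rewrite meanB; [|rewrite -[X in X \in _]/((_ : T -> R) - _) rpredB//|];
  [|by apply/Lr/sum1..].
rewrite meanB; [|by apply/Lr/sum1..].
rewrite !meanZ; [|exact: sum1..].
rewrite !meanss//.
have N0r : 0 < N%:R :> R by rewrite ltr0n.
have M0r : 0 < M%:R :> R by rewrite ltr0n.
have FG : (N%:R * M%:R)^-1 *
    (\sum_(i < N) \sum_(j < M) mean (fun w => (F i w - G j w) ^+ 2)) <= a.
  rewrite ler_pdivrMl ?mulr_gt0//.
  apply: le_trans (_ : \sum_(i < N) \sum_(j < M) a <= _); last first.
    rewrite !sumr_const !card_ord -[_ *+ N]mulr_natr -[a *+ M]mulr_natr.
    by rewrite mulrC [a * _]mulrC mulrA.
  by apply: ler_sum => i _; apply: ler_sum => j _.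
have FF : b / 2 * (1 - N%:R^-1) <= (2 * N%:R ^+ 2)^-1 *
    (\sum_(i < N) \sum_(j < N) mean (fun w => (F i w - F j w) ^+ 2)).
  rewrite ler_pdivlMl ?mulr_gt0 ?exprn_gt0//.
  rewrite [leLHS](_ : _ = b * (N%:R ^+ 2 - N%:R)); last by field; rewrite gt_eqF.
  apply: (@sum_offdiag_ge _ N
    (fun i j => mean (fun w => (F i w - F j w) ^+ 2))) => // i.
  by apply: mean_ge0 => w; exact: sqr_ge0.
have GG : c / 2 * (1 - M%:R^-1) <= (2 * M%:R ^+ 2)^-1 *
    (\sum_(i < M) \sum_(j < M) mean (fun w => (G i w - G j w) ^+ 2)).
  have [M1|] := ltnP 1 M; last first.
    move=> M1; rewrite (_ : M = 1%N) ?invr1 ?subrr ?mulr0; last first.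
      by apply/eqP; rewrite eqn_leq M1.
    rewrite mulr_ge0 ?invr_ge0//; do 2![apply: sumr_ge0 => ? _].
    by apply: mean_ge0 => w; exact: sqr_ge0.
  rewrite ler_pdivlMl ?mulr_gt0 ?exprn_gt0//.
  rewrite [leLHS](_ : _ = c * (M%:R ^+ 2 - M%:R)); last by field; rewrite gt_eqF.
  apply: (@sum_offdiag_ge _ M
    (fun i j => mean (fun w => (G i w - G j w) ^+ 2))).
    by move=> i; apply: mean_ge0 => w; exact: sqr_ge0.
  exact: Gc.
by lra.
Qed.

(* [|x| <= (2^k x^2 + 2^-k) / 2] trades the second moments for summable first moments. *)
Lemma ae_summable F C : (forall k, F k \in Lfun P 2%:E) ->
    (forall k, mean (fun w => F k w ^+ 2) <= C / 4 ^+ k) ->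
  {ae P, forall w, cvgn (series (fun k => `|F k w|))}.
Proof.
move=> F2 FC.
have C0 : 0 <= C.
  have := FC 0%N; rewrite expr0 divr1; apply: le_trans.
  by apply: mean_ge0 => w; exact: sqr_ge0.
have Fm k : measurable_fun setT (F k) by exact: Lfun_measurable (F2 k).
have mF k : measurable_fun setT (fun w => (`|F k w|)%:E).
  by apply/measurable_EFinP; exact: measurableT_comp.
(* The mean of the dominating [g] is at most [2^k/2 * C/4^k + 2^-(k+1)], which is [(C + 1)/2^(k+1)]:
   a geometric series with sum [C + 1]. *)
have Fk k : (\int[P]_w (`|F k w|)%:E <= ((C + 1) / (2 ^ k.+1)%:R)%:E)%E.
  pose g w := 2 ^+ k / 2 * F k w ^+ 2 + (2 ^+ k.+1)^-1.
  have g1 : (fun w => 2 ^+ k / 2 * F k w ^+ 2) \in Lfun P 1.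
    by apply: Lfun_mulr => //; exact: Lfun2_sqr.
  have gL : g \in Lfun P 1.
    by rewrite -[X in X \in _]/((_ : T -> R) + cst _) rpredD// Lfun_cst.
  have k0 : 0 < 2 ^+ k :> R by rewrite exprn_gt0.
  have Fg w : `|F k w| <= g w.
    rewrite -subr_ge0 /g -[F k w ^+ 2]real_normK ?num_real//.
    set x := `|_|; rewrite [leRHS](_ : _ = (2 ^+ k * x - 1) ^+ 2 / (2 * 2 ^+ k)).
      by rewrite divr_ge0 ?sqr_ge0 ?mulr_ge0// ltW.
    by rewrite (exprS 2); field; rewrite gt_eqF.
  apply: (@le_trans _ _ (mean g)%:E).
    rewrite meanK// unlock ge0_le_integral//.
    - by apply/measurable_EFinP; exact: Lfun_measurable gL.
    - by move=> w _; rewrite lee_fin.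
  rewrite lee_fin meanD//; last by rewrite Lfun_cst.
  rewrite meanZ ?mean_cst; last exact: Lfun2_sqr.
  apply: (@le_trans _ _ (2 ^+ k / 2 * (C / 4 ^+ k) + (2 ^+ k.+1)^-1)).
    by rewrite lerD2r ler_wpM2l// divr_ge0// ltW.
  rewrite natrX (exprS 2) (_ : 4 = 2 * 2 :> R) ?exprMn; last by ring.
  by rewrite le_eqVlt; apply/orP; left; apply/eqP; field; rewrite gt_eqF.
have iS : P.-integrable setT (fun w => \sum_(0 <= k <oo) (`|F k w|)%:E)%E.
  apply/integrableP; split.
    by apply: ge0_emeasurable_sum => // k w _ _; rewrite lee_fin.
  under eq_integral do rewrite gee0_abs ?nneseries_ge0//.
  rewrite integral_nneseries//.
  apply: le_lt_trans (_ : _ <= (C + 1)%:E)%E _; last by rewrite ltry.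
  apply: le_trans (epsilon_trick0 xpredT _); last by rewrite addr_ge0.
  by apply: lee_nneseries => // k _ _; exact: integral_ge0.
have := integrable_ae measurableT iS; apply: filterS => w /(_ I) Sw.
by apply: nnseries_is_cvg => //; rewrite ltey_eq Sw.
Qed.

Lemma ae_cvg0 F C : (forall k, F k \in Lfun P 2%:E) ->
    (forall k, mean (fun w => F k w ^+ 2) <= C / 4 ^+ k) ->
  {ae P, forall w, F ^~ w @ \oo --> (0 : R)}.
Proof.
move=> F2 FC; have := ae_summable F2 FC; apply: filterS => w Fw.
by apply/norm_cvg0P; exact: cvg_series_cvg_0.
Qed.

Lemma ae_cvgn F C : (forall k, F k \in Lfun P 2%:E) ->
    (forall k, mean (fun w => (F k.+1 w - F k w) ^+ 2) <= C / 4 ^+ k) ->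
  {ae P, forall w, cvgn (F ^~ w)}.
Proof.
move=> F2 FC; have := ae_summable (fun k => Lfun2B (F2 k.+1) (F2 k)) FC.
apply: filterS => w /normed_cvg Fw.
have -> : F ^~ w = fun n => F 0%N w + series (telescope (F ^~ w)) n.
  by apply/funext => n; exact: eq_sum_telescope.
by apply: is_cvgD; [exact: is_cvg_cst|exact: Fw].
Qed.

End mean.

(* The function with [walk y 0 = 0] and increments [walk y b - walk y (b - 1) = y b];
   recall that [Negz n] is [- n.+1]. *)
Definition walk {R : realType} (y : int -> R) (b : int) : R :=
  match b with
  | Posz n => \sum_(i < n) y i.+1%:Z
  | Negz n => - \sum_(i < n.+1) y (- i%:Z)
  end.

(* [- walk y b] is [Y_0 - Y_b] if [y_k = Y_k - Y_(k-1)]; averaging over a sparse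
   set of times [b] before, respectively after, time 0 recovers [Y_0 - E Y_0]. *)
Definition past_avg {R : realType} (p N : nat) (y : int -> R) : R :=
  - avg N (fun j => walk y (- (p * j.+1)%:Z)).

Definition future_avg {R : realType} (p N : nat) (y : int -> R) : R :=
  - avg N (fun j => walk y (p * j.+1)%:Z).

(** * Walks and their averages over sparse times *)

Section walk.
Context {R : realType}.
Implicit Types (y : int -> R) (b k : int).

Lemma walk0 y : walk y 0 = 0.
Proof. exact: big_ord0. Qed.

Lemma walkN y n : walk y (- n%:Z) = - \sum_(i < n) y (- i%:Z).
Proof.
case: n => [|n]; first by rewrite big_ord0 !oppr0 walk0.
by rewrite -NegzE.
Qed.

Lemma walkD1 y b : walk y (b + 1) = walk y b + y (b + 1).
Proof.
case: b => n.
  by rewrite -PoszD addn1 /walk big_ord_recr.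
rewrite NegzE (_ : - n.+1%:Z + 1 = - n%:Z); last by lia.
by rewrite !walkN big_ord_recr/= opprD addrNK.
Qed.

Lemma walk_addn y b n : walk y (b + n%:Z) - walk y b =
  \sum_(i < n) y (b + 1 + i%:Z).
Proof.
elim: n => [|n ih]; first by rewrite addr0 subrr big_ord0.
rewrite big_ord_recr -ih/= -addn1 PoszD addrA walkD1 [b + 1 + _]addrAC.
by rewrite [RHS]addrAC.
Qed.

Lemma walk_shift y k b : walk (fun i => y (k + i)) b = walk y (k + b) - walk y k.
Proof.
elim: b => [|n ih|n ih].
- by rewrite walk0 addr0 subrr.
- by rewrite -addn1 PoszD walkD1 ih (addrA k n%:Z 1) (walkD1 y (k + n%:Z)); ring.
- have := walkD1 (fun i => y (k + i)) (- n.+1%:Z).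
  have := walkD1 y (k - n.+1%:Z).
  rewrite (_ : - n.+1%:Z + 1 = - n%:Z); last by lia.
  rewrite (_ : k - n.+1%:Z + 1 = k - n%:Z); last by lia.
  by move=> h1 h2; lra.
Qed.

(** Moving the origin from 0 to -1 changes the walk at time [b] by [y 0 - y b]. In the limit of
    large [N] this becomes the coboundary equation, once the averages of [y] tend to 0. *)
Lemma past_avg_shift p N y : (0 < N)%N ->
  past_avg p N y - past_avg p N (fun i => y (- 1 + i)) =
  y 0 - avg N (fun j => y (- (p * j.+1)%:Z)).
Proof.
move=> N0; rewrite -(avg_cst (y 0) N0) /past_avg opprK addrC !avgB.
congr (avg N _); apply/funext => j; set b := - (p * j.+1)%:Z.
have := walkD1 y (-1 + b); have := walkD1 y (-1).
rewrite walk_shift addNr walk0 (_ : -1 + b + 1 = b); last by lia.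
by lra.
Qed.

(** Going back from time 0 the walk reads [y 0], [y (-1)], ..., and going forward it reads [y 1],
    [y 2], .... Past and future thus share no coordinate, and this is where one step of dependence
    is gained. *)
Lemma measurable_past_avg p N (L : set int) : [set k | k <= 0] `<=` L ->
  measurable_fun setT (past_avg p N : coord_type R L -> R).
Proof.
move=> L0; apply: measurableT_comp => //; apply: measurable_funM => //.
apply: measurable_sum => j.
apply: (eq_measurable_fun
    (fun y : coord_type R L => - \sum_(i < p * j.+1) y (- i%:Z))).
  by move=> y _; rewrite -walkN.
apply: measurableT_comp => //; apply: measurable_sum => i.
by apply: measurable_coord; apply: L0 => /=; lia.
Qed.

Lemma measurable_future_avg p N (L : set int) : [set k | 1 <= k] `<=` L ->
  measurable_fun setT (future_avg p N : coord_type R L -> R).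
Proof.
move=> L0; apply: measurableT_comp => //; apply: measurable_funM => //.
apply: measurable_sum => j; apply: measurable_sum => i.
by apply: measurable_coord; apply: L0.
Qed.

End walk.

(** * Walks whose increments have stationary covariances vanishing beyond lag [m] *)

Section second_order.
Context {d : measure_display} {T : measurableType d} {R : realType}.
Variable P : probability T R.
Context (x : int -> T -> R) (gamma : nat -> R) (m : nat).
Hypothesis x2 : forall k, x k \in Lfun P 2%:E.
Hypothesis xgamma : forall a n, mean P (fun w => x a w * x (a + n%:Z) w) = gamma n.
Hypothesis gamma0 : forall n, (m < n)%N -> gamma n = 0.

(** The second moment of a sum of [n] consecutive terms, written by its increments: a new term adds
    its own second moment and twice its covariances with the [i] earlier ones. *)
Definition block_var n : R :=
  \sum_(i < n) (gamma 0 + 2 * \sum_(1 <= k < i.+1) gamma k).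

Lemma mean_sqr_block a n :
  mean P (fun w => (\sum_(i < n) x (a + i%:Z) w) ^+ 2) = block_var n.
Proof.
elim: n => [|n ih].
  under eq_fun do rewrite big_ord0 expr0n.
  by rewrite mean_cst /block_var big_ord0.
pose S w := \sum_(i < n) x (a + i%:Z) w.
have S2 : S \in Lfun P 2%:E by apply: Lfun_sum => //; rewrite lee1n.
pose z := x (a + n%:Z).
have z2 : z \in Lfun P 2%:E by exact: x2.
have -> : (fun w => (\sum_(i < n.+1) x (a + i%:Z) w) ^+ 2) =
    fun w => S w ^+ 2 + (z w * z w + 2 * (S w * z w)).
  by apply/funext => w; rewrite big_ord_recr /= -/(S w) -/(z w); ring.
have Sz1 := Lfun2_mul S2 z2; have zz1 := Lfun2_mul z2 z2.
have Sz21 : (fun w => 2 * (S w * z w)) \in Lfun P 1 by exact: Lfun_mulr.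
rewrite meanD; [|exact: Lfun2_sqr|by rewrite -[X in X \in _]/((_ : T -> R) + _) rpredD].
rewrite ih meanD// meanZ// /block_var big_ord_recr/=; congr (_ + (_ + 2 * _)).
  by have := xgamma (a + n%:Z) 0; rewrite addr0.
under eq_fun do rewrite mulr_suml.
rewrite mean_sum; last by move=> i; exact: Lfun2_mul.
rewrite big_add1/= big_mkord [RHS](reindex_inj rev_ord_inj)/=.
apply: eq_bigr => i _; rewrite -(xgamma (a + i%:Z)); congr (mean P _).
apply/funext => w; congr (_ * x _ w).
by have := ltn_ord i; rewrite subnSK//; lia.
Qed.

(** From index [m] on, the increments of [block_var] are constant because longer lags contribute 0;
    the slope is sigma^2. *)
Lemma block_var_linear n : block_var (m + n) =
  block_var m + n%:R * (gamma 0 + 2 * \sum_(1 <= k < m.+1) gamma k).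
Proof.
elim: n => [|n ih]; first by rewrite addn0 mul0r addr0.
rewrite addnS [LHS]big_ord_recr/= -/(block_var _) ih -addrA; congr (_ + _).
rewrite -[n.+1]addn1 natrD (mulrDl n%:R 1) mul1r; congr (_ + (_ + 2 * _)).
rewrite (big_cat_nat (n := m.+1))//=; last by rewrite ltnS leq_addr.
rewrite [X in _ + X]big_nat_cond [X in _ + X]big1 ?addr0// => i.
by rewrite andbT => /andP[/gamma0].
Qed.

Lemma block_var_ge0 n : 0 <= block_var n.
Proof. by rewrite -(mean_sqr_block 0); apply: mean_ge0 => w; exact: sqr_ge0. Qed.

(* Times that are distinct multiples of [p] differ by more than [m], so that [x] is
   uncorrelated along them and the increments of its walk all have variance [c]. *)
Let p := m.+1.

(** A law of large numbers: the terms are uncorrelated, so an average of [N] of them has second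
    moment at most [gamma 0 / N], which is summable along [N = 4^k]. *)
Lemma ae_avg_sparse_cvg0 :
  {ae P, forall w, avg (4 ^ k) (fun j => x (- (p * j.+1)%:Z) w) @[k --> \oo] --> 0}.
Proof.
pose F j := x (- (p * j.+1)%:Z).
have FL j : F j \in Lfun P 2%:E by exact: x2.
have zz k : mean P (fun w => x k w ^+ 2) = gamma 0.
  by rewrite -(xgamma k); congr (mean P _); apply/funext => w; rewrite addr0.
apply: (@ae_cvg0 _ _ _ _ (fun k w => avg (4 ^ k) (F ^~ w)) (gamma 0)).
  by move=> k; exact: Lfun2_avg.
move=> k.
have k0 : (0 < 4 ^ k)%N by rewrite expn_gt0.
have L0 : (fun=> 0 : R) \in Lfun P 2%:E by exact: Lfun_cst.
have -> : (fun w => avg (4 ^ k) (F ^~ w) ^+ 2) =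
    fun w => (avg (4 ^ k) (F ^~ w) - avg 1 (fun=> 0)) ^+ 2.
  by apply/funext => w; rewrite avg_cst// subr0.
(* Comparison with the single variable 0: a term has second moment [gamma 0], and a difference of
   two uncorrelated terms has [2 * gamma 0]. *)
apply: le_trans (_ : _ <= gamma 0 - gamma 0 * 2 / 2 * (1 - (4 ^ k)%:R^-1) - 0 / 2 * (1 - 1%:R^-1)) _.
  apply: (mean_sqr_avgB (G := fun=> fun=> 0)) => //.
    move=> i j; rewrite -(zz (- (p * i.+1)%:Z)) le_eqVlt; apply/orP; left; apply/eqP.
    by congr (mean P _); apply/funext => w; rewrite subr0.
  have F2 i j : mean P (fun w => F i w * F j w) = gamma (p * `|i - j|)%N.
    wlog ij : i j / (j <= i)%N => [H|].
      have [/H//|/ltnW/H] := leqP j i.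
      by rewrite distnC => <-; congr (mean P _); apply/funext => w; rewrite mulrC.
    rewrite -(xgamma (- (p * i.+1)%:Z)) /F; congr (mean P _).
    apply/funext => w; congr (_ * x _ w).
    have [e ->] : exists e, i = (j + e)%N by exists (i - j)%N; lia.
    by rewrite (_ : `|(j + e)%N - j|%N = e); lia.
  move=> i j ij.
  have -> : (fun w => (F i w - F j w) ^+ 2) =
      fun w => (F i w ^+ 2 + F j w ^+ 2) - 2 * (F i w * F j w).
    by apply/funext => w; ring.
  have FF1 i' : (fun w => F i' w ^+ 2) \in Lfun P 1 by exact: Lfun2_sqr.
  have FFF : (fun w => F i w * F j w) \in Lfun P 1 by exact: Lfun2_mul.
  rewrite meanB; [|by rewrite -[X in X \in _]/((_ : T -> R) + _) rpredD|exact: Lfun_mulr].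
  have gij : gamma (p * `|i - j|)%N = 0.
    have : (0 < `|i - j|)%N by lia.
    by case: (`|i - j|)%N => // e _; rewrite gamma0// mulnS leq_addr.
  by rewrite meanD// !zz meanZ// F2 gij mulr0 subr0 mulr_natr mulr2n.
rewrite natrX invr1 subrr mulr0 subr0 mulfK//.
by rewrite mulrBr mulr1 opprB addrC subrK.
Qed.

Hypothesis degenerate : gamma 0 + 2 * \sum_(1 <= k < m.+1) gamma k = 0.

Let c := block_var m.
Let W b w := walk (fun k => x k w) b.

Lemma Lfun2_walk b : W b \in Lfun P 2%:E.
Proof.
have sumL n (s : nat -> int) : (fun w => \sum_(i < n) x (s i) w) \in Lfun P 2%:E.
  by apply: Lfun_sum => //; rewrite lee1n.
case: b => n; first exact: (sumL n (fun i => i.+1%:Z)).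
have -> : W (Negz n) = - (fun w => \sum_(i < n.+1) x (- i%:Z) w) by [].
by rewrite rpredN ?lee1n//; exact: (sumL n.+1 (fun i => - i%:Z)).
Qed.

(** The increment is a block sum of length [m + n]; with slope 0 its second moment no longer depends
    on [n]. *)
Lemma mean_sqr_walkB a b : (m <= `|a - b|)%N ->
  mean P (fun w => (W a w - W b w) ^+ 2) = c.
Proof.
wlog ab : a b / b <= a => [H|].
  have [/H//|/ltW/H] := leP b a.
  rewrite distnC => + mab => /(_ mab) <-; congr (mean P _).
  by apply/funext => w; ring.
move=> mab; have [n an] : exists n, a = b + (m + n)%N%:Z.
  by exists (`|a - b| - m)%N; lia.
have -> : (fun w => (W a w - W b w) ^+ 2) =
    fun w => (\sum_(i < m + n) x (b + 1 + i%:Z) w) ^+ 2.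
  by apply/funext => w; rewrite an /W walk_addn.
by rewrite mean_sqr_block block_var_linear degenerate mulr0 addr0.
Qed.

(** Two averages may share times; there the increment is 0, and [c] is nonnegative. *)
Lemma mean_sqr_walkB_le a b : a = b \/ (m <= `|a - b|)%N ->
  mean P (fun w => (W a w - W b w) ^+ 2) <= c.
Proof.
move=> [->|ab]; last by rewrite mean_sqr_walkB.
under eq_fun do rewrite subrr expr0n.
by rewrite mean_cst block_var_ge0.
Qed.

(** All three bounds of [mean_sqr_avgB] are the same [c], so the constant part cancels and only the
    diagonal corrections remain. *)
Lemma mean_sqr_avg_walkB (s t : nat -> int) N M : (0 < N)%N -> (0 < M)%N ->
    (forall i j, s i = t j \/ (m <= `|s i - t j|)%N) ->
    (forall i j, i != j -> (m <= `|s i - s j|)%N) ->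
    (forall i j, i != j -> (m <= `|t i - t j|)%N) ->
  mean P (fun w => (avg N (fun j => W (s j) w) - avg M (fun j => W (t j) w)) ^+ 2)
    <= c / 2 * (N%:R^-1 + M%:R^-1).
Proof.
move=> N0 M0 st ss tt.
apply: le_trans (_ : _ <= c - c / 2 * (1 - N%:R^-1) - c / 2 * (1 - M%:R^-1)) _; last by lra.
apply: (mean_sqr_avgB (F := fun j => W (s j)) (G := fun j => W (t j))) => //.
- by move=> i; exact: Lfun2_walk.
- by move=> i; exact: Lfun2_walk.
- by move=> i j; exact: mean_sqr_walkB_le.
- by move=> i j ij; rewrite mean_sqr_walkB// ss.
- by move=> _ i j ij; rewrite mean_sqr_walkB// tt.
Qed.

Let past k w := past_avg p (4 ^ k) (fun i => x i w).
Let future k w := future_avg p (4 ^ k) (fun i => x i w).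

Lemma Lfun2_past k : past k \in Lfun P 2%:E.
Proof.
rewrite -[X in X \in _]/(- (fun w => avg (4 ^ k) (fun j => W (- (p * j.+1)%:Z) w))).
by rewrite rpredN ?lee1n// Lfun2_avg// => j; exact: Lfun2_walk.
Qed.

Lemma Lfun2_future k : future k \in Lfun P 2%:E.
Proof.
rewrite -[X in X \in _]/(- (fun w => avg (4 ^ k) (fun j => W (p * j.+1)%:Z w))).
by rewrite rpredN ?lee1n// Lfun2_avg// => j; exact: Lfun2_walk.
Qed.

Let c0 : 0 <= c. Proof. exact: block_var_ge0. Qed.

Let four_gt0 k : 0 < 4 ^+ k :> R. Proof. by rewrite exprn_gt0. Qed.

(** Successive averages, of lengths [4^k] and [4^(k+1)], differ by at most [c / 4^k] in second
    moment. *)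
Lemma ae_past_cvgn : {ae P, forall w, cvgn (past ^~ w)}.
Proof.
apply: (@ae_cvgn _ _ _ _ past c Lfun2_past) => k.
under eq_fun do rewrite -sqrrN /past /past_avg opprD !opprK.
apply: le_trans; first apply: (mean_sqr_avg_walkB
    (s := fun j => - (p * j.+1)%:Z) (t := fun j => - (p * j.+1)%:Z)).
- by rewrite expn_gt0.
- by rewrite expn_gt0.
- move=> i j; have [->|ij] := eqVneq i j; [by left|right].
  by rewrite /p; nia.
- by move=> i j ij; rewrite /p; nia.
- by move=> i j ij; rewrite /p; nia.
rewrite !natrX exprS mulrAC -mulrA ler_wpM2l// ler_pdivrMr// invfM.
have := four_gt0 k; rewrite -invr_gt0.
by lra.
Qed.

(** A negative and a positive multiple of [p] are at least [2p] apart, so the same bound compares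
    the two sides. *)
Lemma ae_past_future : {ae P, forall w, past k w - future k w @[k --> \oo] --> 0}.
Proof.
apply: (@ae_cvg0 _ _ _ _ (fun k w => past k w - future k w) c).
  by move=> k; apply: Lfun2B; [exact: Lfun2_past|exact: Lfun2_future].
move=> k; under eq_fun do rewrite -sqrrN /past /past_avg opprD !opprK.
apply: le_trans; first apply: (mean_sqr_avg_walkB
    (s := fun j => - (p * j.+1)%:Z) (t := fun j => (p * j.+1)%:Z)).
- by rewrite expn_gt0.
- by rewrite expn_gt0.
- by move=> i j; right; rewrite /p; nia.
- by move=> i j ij; rewrite /p; nia.
- by move=> i j ij; rewrite /p; nia.
by rewrite !natrX; lra.
Qed.

(** Comparison with the single value [W 0 = 0] gives [c/2 * (1 + 4^-k)]. The bound is uniform in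
    [k], as needed for Fatou's lemma. *)
Lemma mean_sqr_past_le k : mean P (fun w => past k w ^+ 2) <= c.
Proof.
have -> : (fun w => past k w ^+ 2) = fun w =>
    (avg (4 ^ k) (fun j => W (- (p * j.+1)%:Z) w) - avg 1 (fun=> 0)) ^+ 2.
  by apply/funext => w; rewrite avg_cst// subr0 -sqrrN opprK.
apply: le_trans (_ : _ <= c - c / 2 * (1 - (4 ^ k)%:R^-1) - 0 / 2 * (1 - 1%:R^-1)) _.
  apply: (mean_sqr_avgB (F := fun j => W (- (p * j.+1)%:Z)) (G := fun=> fun=> 0)) => //.
  - by rewrite expn_gt0.
  - by move=> i; exact: Lfun2_walk.
  - by move=> i; exact: Lfun_cst.
  - move=> i j; set b := - _.
    have -> : (fun w => (W b w - 0) ^+ 2) = fun w => (W b w - W 0 w) ^+ 2.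
      by apply/funext => w; rewrite [W 0 w]walk0.
    by apply: mean_sqr_walkB_le; right; rewrite /b /p; nia.
  - by move=> i j ij; rewrite mean_sqr_walkB// /p; nia.
rewrite invr1 subrr mulr0 subr0 gerBl mulr_ge0// ?divr_ge0//.
by rewrite subr_ge0 invf_le1 ?ler1n ?ltr0n expn_gt0.
Qed.

End second_order.

(** * Covariances and limit variance of a stationary sequence *)

Lemma invn_cvg0 (R : realType) : (n%:R^-1 : R) @[n --> \oo] --> 0.
Proof. by rewrite -cvg_shiftS; exact: cvg_harmonic. Qed.

Section stationary_second_order.
Context {d : measure_display} {T : measurableType d} {R : realType}.
Variable P : probability T R.
Implicit Types X : int -> {RV P >-> R}.

(** One constant is subtracted at all times, so that centering commutes with shifts; under
    stationarity it is the mean of every [X k]. *)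
Definition centered X (k : int) : T -> R := fun w => X k w - mean P (X 0).

Definition autocov X (n : nat) : R :=
  mean P (fun w => centered X 0 w * centered X n w).

Lemma mean_stationary X k : strictly_stationary X -> finite_variance X ->
  mean P (X k) = mean P (X 0).
Proof.
move=> sX vX; congr fine.
have := strictly_stationary_expectation (psi := fun y => y 0) k sX.
rewrite add0r; apply; first exact: measurable_coord.
by move=> h; apply: Lfun1_sub2; exact: Lfun2_finite_variance.
Qed.

Lemma Lfun2_centered X k : finite_variance X -> centered X k \in Lfun P 2%:E.
Proof.
move=> vX; apply: (Lfun2B (g := fun=> mean P (X 0))); last exact: Lfun_cst.
exact: Lfun2_finite_variance.
Qed.

Lemma mean_centeredM X a n : strictly_stationary X -> finite_variance X ->
  mean P (fun w => centered X a w * centered X (a + n%:Z) w) = autocov X n.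
Proof.
move=> sX vX; congr fine.
have := strictly_stationary_expectation
  (psi := fun y => (y 0 - mean P (X 0)) * (y n%:Z - mean P (X 0))) a sX.
rewrite add0r [a + _]addrC; apply.
  by apply: measurable_funM; apply: measurable_funB => //; exact: measurable_coord.
by move=> h; apply: Lfun2_mul; exact: Lfun2_centered.
Qed.

Lemma covariance_autocov X (n : nat) : strictly_stationary X -> finite_variance X ->
  covariance P (X 0) (X n) = (autocov X n)%:E.
Proof.
move=> sX vX; rewrite /autocov meanK; last by apply: Lfun2_mul; exact: Lfun2_centered.
by rewrite unlock -!/(mean _ _) mean_stationary.
Qed.

Lemma autocov_eq0 X m n : strictly_stationary X -> finite_variance X ->
  m_dependent m X -> (m < n)%N -> autocov X n = 0.
Proof.
move=> sX vX dX mn; apply/EFin_inj; rewrite -covariance_autocov//.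
have X2 k : (X k : T -> R) \in Lfun P 2%:E by exact: Lfun2_finite_variance.
have X1 k := Lfun1_sub2 (X2 k).
rewrite covarianceE//; last exact: Lfun2_mul.
rewrite expectation_indepM// ?subee// ?fin_numM ?expectation_fin_num//.
move=> A B mA mB; apply: dX.
- exact: (sigma_family_coord (f := X)).
- by apply: (sigma_family_coord (f := X)) => //=; lia.
Qed.

Lemma variance_partial_sum X n : strictly_stationary X -> finite_variance X ->
  'V_P[partial_sum X n]%E = (block_var (autocov X) n)%:E.
Proof.
move=> sX vX.
have X2 k : (X k : T -> R) \in Lfun P 2%:E by exact: Lfun2_finite_variance.
have X1 k := Lfun1_sub2 (X2 k).
have SE w : partial_sum X n w = \sum_(i < n) X (1 + i%:Z) w.
  by rewrite /partial_sum big_add1 big_mkord.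
have ES : mean P (partial_sum X n) = n%:R * mean P (X 0).
  rewrite (_ : partial_sum X n = fun w => \sum_(i < n) X (1 + i%:Z) w); last first.
    exact/funext.
  rewrite mean_sum//; under eq_bigr do rewrite mean_stationary//.
  by rewrite sumr_const card_ord mulr_natl.
rewrite -(mean_sqr_block (x := centered X) (P := P) _ _ 1); last 2 first.
- by move=> k; exact: Lfun2_centered.
- by move=> a k; exact: mean_centeredM.
rewrite meanK; last first.
  apply: Lfun2_sqr; apply: Lfun_sum => [|i]; first by rewrite lee1n.
  exact: Lfun2_centered.
rewrite /variance unlock -/(mean P _) ES; congr expectation; apply/funext => w.
rewrite -[LHS]expr2 /= SE; congr (_ ^+ 2); rewrite sumrB; congr (_ - _).
by rewrite sumr_const card_ord mulr_natl.
Qed.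

Definition long_run_var X m : R :=
  autocov X 0 + 2 * \sum_(1 <= k < m.+1) autocov X k.

Lemma normalized_var_cvg X m : strictly_stationary X -> finite_variance X ->
  m_dependent m X -> normalized_var X n @[n --> \oo] --> (long_run_var X m)%:E.
Proof.
move=> sX vX dX; set s := long_run_var X m.
pose K := block_var (autocov X) m - m%:R * s.
(* For [N > m] the variance of the partial sum is affine in [N], with slope [s] and intercept [K];
   divided by [N] it is [s + K / N]. *)
rewrite -(cvg_shiftn m.+1).
have -> : [sequence normalized_var X (n + m.+1)%N]_n =
    EFin \o (fun n => s + ((n + m.+1)%:R)^-1 * K).
  apply/funext => n /=; rewrite /normalized_var variance_partial_sum// -EFinM.
  congr EFin; have N0 : (n + m.+1)%:R != 0 :> R by rewrite pnatr_eq0 addnS.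
  have Nm : n.+1%:R = (n + m.+1)%:R - m%:R :> R by rewrite addnS -addSn natrD addrK.
  rewrite [X in block_var _ X](_ : _ = m + n.+1)%N; last by lia.
  rewrite block_var_linear; last by move=> k; exact: autocov_eq0.
  by rewrite -/(long_run_var X m) -/s Nm /K; move: N0; set N := (n + _)%:R => N0; field.
apply/cvg_EFin; first by near=> n.
rewrite -[X in _ --> X](addr0 s) -[X in _ --> _ + X](mul0r K).
apply: cvgD; first exact: cvg_cst.
apply: cvgM; last exact: cvg_cst.
by have := @invn_cvg0 R; rewrite -(cvg_shiftn m.+1).
Unshelve. all: by end_near.
Qed.

Lemma long_run_varE X m : strictly_stationary X -> finite_variance X ->
  (long_run_var X m)%:E = ('V_P[X 0%R] +
    2%:E * \sum_(1 <= k < m.+1) covariance P (X 0%R) (X k%:Z))%E.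
Proof.
move=> sX vX; rewrite /long_run_var /variance covariance_autocov// EFinD EFinM.
by congr (_ + _ * _)%E; rewrite -sumEFin; apply: eq_bigr => k _; rewrite covariance_autocov.
Qed.

Lemma ae_avg_sparse_cvg X m : strictly_stationary X -> finite_variance X ->
    m_dependent m X ->
  {ae P, forall w, avg (4 ^ k) (fun j => X (- (m.+1 * j.+1)%:Z) w) @[k --> \oo]
    --> mean P (X 0)}.
Proof.
move=> sX vX dX.
have : {ae P, forall w, avg (4 ^ k)
    (fun j => centered X (- (m.+1 * j.+1)%:Z) w) @[k --> \oo] --> 0}.
  apply: (ae_avg_sparse_cvg0 (gamma := autocov X)).
  - by move=> k; exact: Lfun2_centered.
  - by move=> a n; exact: mean_centeredM.
  - by move=> n; exact: autocov_eq0.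
apply: filterS => w Xw; rewrite -[X in _ --> X]add0r.
have -> : (fun k => avg (4 ^ k) (fun j => X (- (m.+1 * j.+1)%:Z) w)) = fun k =>
    avg (4 ^ k) (fun j => centered X (- (m.+1 * j.+1)%:Z) w) + mean P (X 0).
  apply/funext => k; apply/eqP; rewrite -subr_eq.
  by rewrite -[X in _ - X](@avg_cst _ (4 ^ k)) ?expn_gt0// avgB.
by apply: cvgD => //; exact: cvg_cst.
Qed.

End stationary_second_order.

(* Total and measurable, unlike [limn]; a junk value on divergent sequences. *)
Definition upper_lim {R : realType} (u : nat -> R) : R :=
  fine (limn_esup (EFin \o u)).

Lemma upper_lim_cvg {R : realType} (u : nat -> R) l :
  u @ \oo --> l -> upper_lim u = l.
Proof.
move=> ul; have /cvg_limn_einf_sup[_ ulE] : EFin \o u @ \oo --> l%:E.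
  by apply/cvg_EFin => //; near=> n.
by rewrite /upper_lim ulE.
Unshelve. all: by end_near.
Qed.

Lemma measurable_upper_lim d (T : measurableType d) (R : realType)
    (f : nat -> T -> R) : (forall n, measurable_fun setT (f n)) ->
  measurable_fun setT (fun w => upper_lim (f ^~ w)).
Proof.
move=> mf; apply: measurableT_comp => //.
apply: (measurable_fun_limn_esup (f := fun n w => (f n w)%:E)) => n.
exact/measurable_EFinP.
Qed.

Lemma ae_forall_int d (T : measurableType d) (R : realType)
    (P : {measure set T -> \bar R}) (Q : int -> T -> Prop) :
  (forall k, {ae P, forall w, Q k w}) -> {ae P, forall w, forall k, Q k w}.
Proof.
move=> PQ; have pos := ae_foralln (fun n => PQ (Posz n)).
have neg := ae_foralln (fun n => PQ (Negz n)).
by apply: filterS2 pos neg => w pos neg [].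
Qed.

(** * Coboundaries: uniqueness, construction and converse *)

Section coboundary.
Context {d : measure_display} {T : measurableType d} {R : realType}.
Variable P : probability T R.
Implicit Types X Y : int -> {RV P >-> R}.

Lemma mean_ae_eq (f g : T -> R) : measurable_fun setT f -> measurable_fun setT g ->
  {ae P, forall w, f w = g w} -> mean P f = mean P g.
Proof.
move=> mf mg fg; congr fine; rewrite unlock.
apply: ae_eq_integral => //; try exact/measurable_EFinP.
by apply: filterS fg => w fgw _; rewrite /= fgw.
Qed.

(** The means of the two [Y] terms cancel by stationarity. Hence any two representations of [X] have
    the same constant. *)
Lemma coboundary_mean X Y mu : strictly_stationary Y -> finite_variance Y ->
    (forall k, {ae P, forall w, X k w = Y k w - Y (k - 1) w + mu}) ->
  mean P (X 0) = mu.
Proof.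
move=> sY vY XY; have Y1 k : (Y k : T -> R) \in Lfun P 1.
  by apply: Lfun1_sub2; exact: Lfun2_finite_variance.
rewrite (mean_ae_eq (g := fun w => (Y 0 w - Y (0 - 1) w) + mu))//; last first.
  by apply: measurable_funD => //; exact: measurable_funB.
rewrite meanD; [|by rewrite -[X in X \in _]/((_ : T -> R) - _) rpredB|exact: Lfun_cst].
by rewrite meanB// mean_cst !(mean_stationary (0 - 1))// subrr add0r.
Qed.

(** Sparse averages of [Y'] and [Y] tend to their means, which identifies the difference, already
    independent of [k]. *)
Lemma coboundary_unique X Y Y' m mu :
    strictly_stationary Y -> m_dependent m Y -> finite_variance Y ->
    strictly_stationary Y' -> m_dependent m Y' -> finite_variance Y' ->
    (forall k, {ae P, forall w, X k w = Y k w - Y (k - 1) w + mu}) ->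
    (forall k, {ae P, forall w, X k w = Y' k w - Y' (k - 1) w + mu}) ->
  forall k, {ae P, forall w, Y' k w = Y k w + (mean P (Y' 0) - mean P (Y 0))}.
Proof.
move=> sY dY vY sY' dY' vY' XY XY' k0.
have Yavg := ae_avg_sparse_cvg sY vY dY.
have Y'avg := ae_avg_sparse_cvg sY' vY' dY'.
have XYXY' : {ae P, forall w, forall k,
    Y k w - Y (k - 1) w + mu = Y' k w - Y' (k - 1) w + mu}.
  by apply: ae_forall_int => k; apply: filterS2 (XY k) (XY' k) => w <- <-.
apply: filterS3 XYXY' Yavg Y'avg => w {}XY {}Yavg {}Y'avg.
have step k : Y' k w - Y k w = Y' (k - 1) w - Y (k - 1) w.
  by have := XY k; lra.
have const k : Y' k w - Y k w = Y' 0 w - Y 0 w.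
  elim: k => // n <-; first by rewrite step; congr (Y' _ w - Y _ w); lia.
  by rewrite [RHS]step; congr (Y' _ w - Y _ w); lia.
have : avg (4 ^ k) (fun j => Y' (- (m.+1 * j.+1)%:Z) w) -
       avg (4 ^ k) (fun j => Y (- (m.+1 * j.+1)%:Z) w) @[k --> \oo] -->
       mean P (Y' 0) - mean P (Y 0) by exact: cvgB.
rewrite (_ : (fun _ => _) = fun=> Y' k0 w - Y k0 w); last first.
  apply/funext => k; rewrite avgB const -[RHS](@avg_cst _ (4 ^ k)) ?expn_gt0//.
  by congr avg; apply/funext => j; rewrite const.
by move=> /(cvg_lim (@Rhausdorff R)) <-; rewrite lim_cst// subrKC.
Qed.

(** * Construction of [Y] when sigma^2 = 0 *)

Section construction.
Context (X : int -> {RV P >-> R}) (m : nat).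
Hypothesis sX : strictly_stationary X.
Hypothesis dX : m_dependent m X.
Hypothesis vX : finite_variance X.
Hypothesis s0 : long_run_var X m = 0.

Let mu := mean P (X 0).
(** Functionals on the sequence space rather than random variables: applied to [X] shifted by [k], a
    single functional yields every [Y_k], whence stationarity. *)
Let past k (y : int -> R) := past_avg m.+1 (4 ^ k) (fun i => y i - mu).
Let future k (y : int -> R) := future_avg m.+1 (4 ^ k) (fun i => y i - mu).
Let past_lim (y : int -> R) := upper_lim (past ^~ y).
Let future_lim (y : int -> R) := upper_lim (future ^~ y).

Let measurable_center (L : set int) :
  measurable_fun setT ((fun y i => y i - mu) : coord_type R L -> coord_type R L).
Proof.
apply: (measurable_seq_of (X := fun i (y : coord_type R L) => y i - mu)) => k Lk.
by apply: measurable_funB => //; exact: measurable_coord.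
Qed.

Let measurable_past_lim :
  measurable_fun setT (past_lim : coord_type R [set k | k <= 0] -> R).
Proof.
apply: measurable_upper_lim => n.
apply: (measurableT_comp (f := past_avg m.+1 (4 ^ n) : coord_type R [set k | k <= 0] -> R)).
  exact: measurable_past_avg.
exact: measurable_center.
Qed.

Let measurable_future_lim :
  measurable_fun setT (future_lim : coord_type R [set k | 1 <= k] -> R).
Proof.
apply: measurable_upper_lim => n.
apply: (measurableT_comp (f := future_avg m.+1 (4 ^ n) : coord_type R [set k | 1 <= k] -> R)).
  exact: measurable_future_avg.
exact: measurable_center.
Qed.

Let measurable_past_limT : measurable_fun setT (past_lim : coord_type R setT -> R).
Proof. exact: (measurable_coord_reindex (s := id)) measurable_past_lim. Qed.

Let Yfun (k : int) w := past_lim (fun i => X (k + i) w).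
(** The almost sure version of [Yfun k] that reads [X] only after time [k]. *)
Let Zfun (k : int) w := future_lim (fun i => X (k + i) w).

Let measurable_Y k : measurable_fun setT (Yfun k).
Proof.
apply: (measurableT_comp measurable_past_limT).
exact: (measurable_seq_of (X := fun i => X (k + i))).
Qed.

Definition potential (k : int) : {RV P >-> R} := mfun_Sub (mem_set (measurable_Y k)).

Let Lfun2_x (k i : int) : (fun w => X (k + i) w - mu) \in Lfun P 2%:E.
Proof. exact: Lfun2_centered. Qed.

Let cov_x (k a : int) n :
  mean P (fun w => (X (k + a) w - mu) * (X (k + (a + n%:Z)) w - mu)) = autocov X n.
Proof. by rewrite addrA; exact: mean_centeredM. Qed.

Let autocov0 n : (m < n)%N -> autocov X n = 0.
Proof. exact: autocov_eq0. Qed.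

Let past_cvg k : {ae P, forall w,
  past n (fun i => X (k + i) w) @[n --> \oo] --> potential k w}.
Proof.
have := ae_past_cvgn (Lfun2_x k) (cov_x k) autocov0 s0.
apply: filterS => w /cvg_ex[/= l pl].
by rewrite /potential /= /Yfun /past_lim (upper_lim_cvg pl).
Qed.

Let potential_future k : {ae P, forall w, potential k w = Zfun k w}.
Proof.
have := ae_past_future (Lfun2_x k) (cov_x k) autocov0 s0.
apply: filterS2 (past_cvg k) => w pY pf; apply/esym/upper_lim_cvg.
rewrite -[X in _ --> X]subr0.
rewrite (_ : future ^~ _ = fun n => past n (fun i => X (k + i) w) -
  (past n (fun i => X (k + i) w) - future n (fun i => X (k + i) w))).
  exact: cvgB.
by apply/funext => n; rewrite subKr.
Qed.

Lemma potential_stationary : strictly_stationary potential.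
Proof. exact: (strictly_stationary_factor sX measurable_past_limT). Qed.

(** For [k <= 0], [potential k] reads [X] up to time 0. For [k >= m] its version [Zfun k] reads [X]
    from time [k + 1 >= m + 1] on. These parts of [X] are independent, so a gap of [m] suffices. *)
Lemma potential_dependent : (0 < m)%N -> m_dependent m.-1 potential.
Proof.
move=> m0.
apply: (@indep_families_ae _ _ _ P potential Zfun _ _
  (sigma_family X [set k | k <= 0]) (sigma_family X [set k | m.+1%:Z <= k])).
- exact: sigma_family_sigma_algebra.
- by apply: sigma_family_measurable.
- by apply: sigma_family_measurable.
- exact: dX.
- apply: (sigma_family_factor (phi := fun k y => past_lim (fun i => y (k + i)))).
  move=> k /= k0; apply: (measurable_coord_reindex (s := fun i => k + i)) measurable_past_lim.
  by move=> _ [i /= i0 <-]; lia.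
- apply: (sigma_family_factor (phi := fun k y => future_lim (fun i => y (k + i)))).
  move=> k /= k0; apply: (measurable_coord_reindex (s := fun i => k + i)) measurable_future_lim.
  by move=> _ [i /= i0 <-]; lia.
- exact: ae_forall_int potential_future.
Qed.

(** Pass to the limit in [past_avg_shift] with time [k] as origin; the sparse averages of the
    centered [X] vanish. *)
Lemma potential_coboundary k :
  {ae P, forall w, X k w = potential k w - potential (k - 1) w + mean P (X 0)}.
Proof.
have := ae_avg_sparse_cvg0 (Lfun2_x k) (cov_x k) autocov0.
apply: filterS3 (past_cvg k) (past_cvg (k - 1)) => w pk pk1 avg0.
suff -> : potential k w - potential (k - 1) w = X k w - mu.
  by rewrite subrK.
have pkk1 : past n (fun i => X (k + i) w) - past n (fun i => X (k - 1 + i) w)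
    @[n --> \oo] --> potential k w - potential (k - 1) w by exact: cvgB.
rewrite -(cvg_lim (@Rhausdorff R) pkk1).
have avgX : (X k w - mu) - avg (4 ^ n) (fun j =>
    X (k + - (m.+1 * j.+1)%:Z) w - mu) @[n --> \oo] --> X k w - mu - 0.
  by apply: cvgB avg0; exact: cvg_cst.
rewrite (subr0 (X k w - mu)) in avgX.
rewrite -(cvg_lim (@Rhausdorff R) avgX); congr (limn _); apply/funext => n.
have := @past_avg_shift _ m.+1 (4 ^ n) (fun i => X (k + i) w - mu).
rewrite expn_gt0 addr0 => /(_ isT) <-.
by congr (_ - past_avg _ _ _); apply/funext => i; rewrite addrA.
Qed.

(** Fatou's lemma along the past averages, whose second moments are bounded by
    [block_var (autocov X) m]. *)
Lemma potential_finite_variance : finite_variance potential.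
Proof.
move=> k; pose u n w := ((past n (fun i => X (k + i) w) ^+ 2)%:E).
have mu2 n : measurable_fun setT (u n).
  apply/measurable_EFinP/measurable_funX.
  exact: (Lfun_measurable (Lfun2_past m (Lfun2_x k) n)).
have u0 n w : (0 <= u n w)%E by rewrite lee_fin sqr_ge0.
have le1 : ('E_P[fun w => (potential k w ^+ 2)%R] <=
    \int[P]_w limn_einf (u ^~ w))%E.
  rewrite unlock; apply: ae_ge0_le_integral => //.
  - by move=> w _; rewrite lee_fin sqr_ge0.
  - by apply/measurable_EFinP; exact: measurable_funX.
  - by move=> w _; rewrite limn_einf_lim lime_ge//; [exact: is_cvg_einfs|
      near=> n; apply: le_ereal_inf_tmp => _ [i _ <-]; exact: u0].
  - apply: measurableT_comp => //.
    apply: (measurable_fun_limn_esup (f := fun n w => (- u n w)%E)) => n.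
    exact: measurableT_comp.
  - apply: filterS (past_cvg k) => w pk _.
    have /cvg_limn_einf_sup[-> _] // : u ^~ w @ \oo --> (potential k w ^+ 2)%:E.
    apply/cvg_EFin; first by near=> n.
    exact: (cvgM pk pk).
apply: (le_lt_trans le1); apply: (le_lt_trans (fatou P measurableT mu2 _)) => //.
apply: (@le_lt_trans _ _ (block_var (autocov X) m)%:E); last by rewrite ltry.
rewrite limn_einf_lim; apply: lime_le; first exact: is_cvg_einfs.
near=> n; apply: (@le_trans _ _ (\int[P]_w u n w)%E).
  by apply: ereal_inf_lbound; exists n => /=.
have := mean_sqr_past_le (Lfun2_x k) (cov_x k) autocov0 s0 n.
rewrite -lee_fin meanK; first by rewrite unlock.
by apply: Lfun2_sqr; exact: (Lfun2_past m (Lfun2_x k) n).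
Unshelve. all: by end_near.
Qed.

End construction.

(** * Differences of a stationary dependent sequence *)

Section converse.
Context (Y : int -> {RV P >-> R}) (m : nat) (mu : R).
Hypothesis sY : strictly_stationary Y.
Hypothesis dY : m_dependent m Y.
Hypothesis vY : finite_variance Y.

Let X : int -> {RV P >-> R} := fun k => Y k - Y (k - 1) + cst mu.

Let XE k w : X k w = Y k w - Y (k - 1) w + mu. Proof. by []. Qed.

Lemma coboundary_stationary : strictly_stationary X.
Proof.
apply: (strictly_stationary_factor (phi := fun y => y 0 - y (-1) + mu) sY).
  by apply: measurable_funD => //; apply: measurable_funB; exact: measurable_coord.
by move=> k w; rewrite addr0.
Qed.

(** [X k] reads [Y] at [k] and [k - 1]: times up to 0 stay there, and times from [m + 2] on read [Y]
    from [m + 1] on. *)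
Lemma coboundary_dependent : m_dependent m.+1 X.
Proof.
have XY K L : [set k | K k \/ K (k + 1)] `<=` L ->
    sigma_family X K `<=` sigma_family Y L.
  move=> KL; apply: (sigma_family_factor (phi := fun k y => y k - y (k - 1) + mu)).
  move=> k Kk; apply: measurable_funD => //; apply: measurable_funB.
    by apply: measurable_coord; apply: KL; left.
  by apply: measurable_coord; apply: KL; right; rewrite subrK.
move=> A B XA XB; apply: dY; [move: A XA|move: B XB]; apply: XY => k /=; lia.
Qed.

Lemma coboundary_finite_variance : finite_variance X.
Proof.
have Y2 := Lfun2_finite_variance vY.
move=> k; rewrite -Lfun2_expectation//.
apply: (Lfun2D (f := fun w => Y k w - Y (k - 1) w) (g := fun=> mu)).
  by apply: Lfun2B; exact: Y2.
exact: Lfun_cst.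
Qed.

(** The centered partial sums telescope to [Y_n - Y_0], so their variances stay bounded by [B], and
    division by [n] sends them to 0. *)
Lemma coboundary_normalized_var : normalized_var X n @[n --> \oo] --> 0%E.
Proof.
have sX := coboundary_stationary; have vX := coboundary_finite_variance.
have Y2 := Lfun2_finite_variance vY.
pose B := 4 * mean P (fun w => centered Y 0 w ^+ 2).
have y2 k : centered Y k \in Lfun P 2%:E by exact: Lfun2_centered.
have yy k : mean P (fun w => centered Y k w ^+ 2) = mean P (fun w => centered Y 0 w ^+ 2).
  by have := mean_centeredM k 0 sY vY; rewrite addr0.
have XB n : block_var (autocov X) n <= B.
  rewrite -(mean_sqr_block (x := centered X) (P := P) _ _ 1); last 2 first.
  - by move=> k; exact: Lfun2_centered.
  - by move=> a k; exact: mean_centeredM.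
  have -> : (fun w => (\sum_(i < n) centered X (1 + i%:Z) w) ^+ 2) =
      fun w => (centered Y n w - centered Y 0 w) ^+ 2.
    apply/funext => w; congr (_ ^+ 2); rewrite /centered.
    rewrite (coboundary_mean (X := X) sY vY (fun k => aeW P (XE k))).
    rewrite (eq_bigr (fun i : 'I_n => Y i.+1 w - Y i w)); last first.
      move=> i _; rewrite XE addrK; congr (Y _ w - Y _ w); lia.
    by rewrite -(big_mkord xpredT (fun i => Y i.+1 w - Y i w)) telescope_sumr//; ring.
  have S1 : (fun w => (centered Y n w + centered Y 0 w) ^+ 2) \in Lfun P 1.
    by apply: Lfun2_sqr; exact: Lfun2D.
  have y1 k : (fun w => centered Y k w ^+ 2) \in Lfun P 1 by exact: Lfun2_sqr.
  (* By the parallelogram identity, dropping the square of the sum leaves twice the two variances,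
     that is [4 Var Y_0 = B]. *)
  have -> : (fun w => (centered Y n w - centered Y 0 w) ^+ 2) = fun w =>
      2 * (centered Y n w ^+ 2 + centered Y 0 w ^+ 2) -
      (centered Y n w + centered Y 0 w) ^+ 2.
    by apply/funext => w; ring.
  have yD : (fun w => centered Y n w ^+ 2 + centered Y 0 w ^+ 2) \in Lfun P 1.
    by rewrite -[X in X \in _]/((_ : T -> R) + _) rpredD.
  rewrite meanB//; last exact: Lfun_mulr.
  rewrite meanZ// meanD// yy.
  have : 0 <= mean P (fun w => (centered Y n w + centered Y 0 w) ^+ 2).
    by apply: mean_ge0 => w; exact: sqr_ge0.
  by rewrite /B; lra.
have -> : normalized_var X = EFin \o (fun n => n%:R^-1 * block_var (autocov X) n).
  by apply/funext => n; rewrite /normalized_var variance_partial_sum.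
apply/cvg_EFin; first by near=> n.
apply: (squeeze_cvgr (f := fun=> 0) (h := fun n => n%:R^-1 * B)).
- near=> n; rewrite mulr_ge0 ?invr_ge0//=.
    by rewrite ler_wpM2l ?invr_ge0.
  rewrite -(mean_sqr_block (x := centered X) (P := P) _ _ 1); last 2 first.
  + by move=> k; exact: Lfun2_centered.
  + by move=> a k; exact: mean_centeredM.
  by apply: mean_ge0 => w; exact: sqr_ge0.
- exact: cvg_cst.
- rewrite -[X in _ --> X](mul0r B); apply: cvgM; [exact: invn_cvg0|exact: cvg_cst].
Unshelve. all: by end_near.
Qed.

End converse.

End coboundary.

Theorem theorem1p1 (R : realType) (d : measure_display) (T : measurableType d)
    (P : probability T R) (m : nat) (hm : (1 <= m)%N) :
  (forall X : int -> {RV P >-> R},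
     strictly_stationary X -> m_dependent m X -> finite_variance X ->
     [/\ cvgn (normalized_var X),
         sigma2 X = ('V_P[X 0%R] +
           2%:E * \sum_(1 <= k < m.+1) covariance P (X 0%R) (X k%:Z))%E
       & sigma2 X = 0%E ->
         exists (Y : int -> {RV P >-> R}) (mu : R),
           [/\ strictly_stationary Y, m_dependent m.-1 Y, finite_variance Y,
               forall k : int, {ae P, forall w, X k w = Y k w - Y (k - 1) w + mu}
             & forall (Y' : int -> {RV P >-> R}) (mu' : R),
                 strictly_stationary Y' -> m_dependent m.-1 Y' ->
                 finite_variance Y' ->
                 (forall k : int,
                    {ae P, forall w, X k w = Y' k w - Y' (k - 1) w + mu'}) ->
                 exists C : R, forall k : int,
                   {ae P, forall w, Y' k w = Y k w + C}]])
  /\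
  (forall (Y : int -> {RV P >-> R}) (mu : R),
     strictly_stationary Y -> m_dependent m.-1 Y -> finite_variance Y ->
     let X : int -> {RV P >-> R} := fun k => Y k - Y (k - 1) + cst mu in
     [/\ strictly_stationary X, m_dependent m X, cvgn (normalized_var X)
       & sigma2 X = 0%E]).
Proof.
split=> [X sX dX vX|Y mu sY dY vY X].
  have Xcvg := normalized_var_cvg sX vX dX.
  have s2E : sigma2 X = (long_run_var X m)%:E by exact/cvg_lim.
  split; first by apply/cvg_ex; eexists; exact: Xcvg.
    by rewrite s2E long_run_varE.
  rewrite s2E => -[s0]; exists (potential X m), (mean P (X 0)).
  have sY := potential_stationary m sX.
  have dY : m_dependent m.-1 (potential X m) by exact: potential_dependent.
  have vY : finite_variance (potential X m) by exact: potential_finite_variance.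
  have XY k := potential_coboundary sX dX vX s0 k.
  split=> // Y' mu' sY' dY' vY' XY'; exists (mean P (Y' 0) - mean P (potential X m 0)).
  apply: (coboundary_unique sY dY vY sY' dY' vY' XY).
  (* Taking means shows that [mu'] is the mean of [X 0], the constant chosen for [potential]. *)
  by rewrite (coboundary_mean sY' vY' XY').
have X0 := coboundary_normalized_var mu sY vY.
split.
- exact: coboundary_stationary.
- by rewrite -(prednK hm); exact: coboundary_dependent.
- by apply/cvg_ex; eexists; exact: X0.
- exact/cvg_lim.
Qed.
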